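(* For any $X,Y\in\{\Gamma,\Delta\}$ the following holds. Let $S$ be the weight function of the stochastic $X$ vertex with spectral parameter $z_i$, $T$ that of the stochastic $Y$ vertex with spectral parameter $z_j$, and $R=R_{XY}$ that of the stochastic $X$-$Y$ vertex with spectral parameters $z_i,z_j$. Then for every choice of spins $a,b,c,d,e,f\in\{+,-\}$, $$\sum_{g,h,k\in\{+,-\}} R(a,b,g,k)\,S(g,c,d,h)\,T(k,h,e,f)=\sum_{j,m,l\in\{+,-\}} T(b,c,j,m)\,S(a,m,l,f)\,R(l,j,d,e).$$
   Context: Parameters: $q,z_i,z_j$ are indeterminates (equivalently, generic complex numbers for which every denominator is nonzero); $z_i'=q+1-\frac1{z_i}$, $z_j'=q+1-\frac1{z_j}$. Spins take values in $\{+,-\}$. Any configuration not listed has weight $0$. Ordinary vertices: the weight of a vertex is a function of the spins (left, top, right, bottom). - Stochastic $\Gamma$ vertex with parameter $z$: $(+,+,+,+)\mapsto 1$, $(-,-,-,-)\mapsto 1$, $(+,-,+,-)\mapsto z$, $(-,+,-,+)\mapsto qz$, $(-,+,+,-)\mapsto 1-qz$, $(+,-,-,+)\mapsto 1-z$. - Stochastic $\Delta$ vertex with parameter $z$ (with $z'=q+1-1/z$): $(+,+,+,+)\mapsto 1$, $(-,-,-,-)\mapsto 1$, $(+,-,+,-)\mapsto z'$, $(-,+,-,+)\mapsto \frac1q z'$, $(-,-,+,+)\mapsto 1-z'$, $(+,+,-,-)\mapsto 1-\frac1q z'$. R-vertices with spectral parameters $z_i,z_j$: the weight is a function of the spins (bottom-left,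 top-left, top-right, bottom-right). In all four types $(+,+,+,+)\mapsto 1$ and $(-,-,-,-)\mapsto 1$; moreover: - $\Gamma$-$\Gamma$, with $P=1-(q+1)z_j+qz_iz_j$: $(+,-,+,-)\mapsto\frac{z_i-z_j}{P}$, $(-,+,-,+)\mapsto\frac{q(z_i-z_j)}{P}$, $(-,+,+,-)\mapsto\frac{(1-qz_i)(1-z_j)}{P}$, $(+,-,-,+)\mapsto\frac{(1-z_i)(1-qz_j)}{P}$. - $\Delta$-$\Gamma$: $(+,-,+,-)\mapsto\frac{z_i'+qz_j-(q+1)z_i'z_j}{1-z_i'z_j}$, $(-,+,-,+)\mapsto\frac{q^{-1}z_i'+z_j-(1+q^{-1})z_i'z_j}{1-z_i'z_j}$, $(-,-,+,+)\mapsto\frac{(1-z_i')(1-qz_j)}{1-z_i'z_j}$, $(+,+,-,-)\mapsto\frac{(1-q^{-1}z_i')(1-z_j)}{1-z_i'z_j}$. - $\Delta$-$\Delta$, with $Q=q-(q+1)z_i'+z_i'z_j'$: $(+,-,+,-)\mapsto\frac{z_j'-z_i'}{Q}$, $(-,+,-,+)\mapsto\frac{q(z_j'-z_i')}{Q}$, $(-,+,+,-)\mapsto\frac{(1-z_i')(q-z_j')}{Q}$, $(+,-,-,+)\mapsto\frac{(1-z_j')(q-z_i')}{Q}$. - $\Gamma$-$\Delta$: $(+,-,+,-)\mapsto\frac{qz_i+z_j'-(1+q)}{z_iz_j'-1}$, $(-,+,-,+)\mapsto\frac{qz_i+z_j'-(1+q)}{q(z_iz_j'-1)}$, $(-,-,+,+)\mapsto\frac{(1-qz_i)(1-z_j')}{z_iz_j'-1}$,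 $(+,+,-,-)\mapsto\frac{(1-z_i)(q-z_j')}{q(z_iz_j'-1)}$. *)

(* Defs.v *)
From HB Require Import structures.
From mathcomp Require Import all_boot all_algebra.

Set Implicit Arguments.
Unset Strict Implicit.
Unset Printing Implicit Defensive.

Import GRing.Theory.
Local Open Scope ring_scope.

Inductive spin : Type := Plus | Minus.

Definition bool_of_spin (s : spin) : bool := if s is Plus then true else false.
Definition spin_of_bool (b : bool) : spin := if b then Plus else Minus.
Lemma bool_of_spinK : cancel bool_of_spin spin_of_bool. Proof. by case. Qed.
HB.instance Definition _ := Countable.copy spin (can_type bool_of_spinK).
HB.instance Definition _ : isFinite spin := CanIsFinite bool_of_spinK.

Declare Scope spin_scope.
Delimit Scope spin_scope with spin.
Bind Scope spin_scope with spin.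
Notation "⊕" := Plus : spin_scope.
Notation "⊖" := Minus : spin_scope.

Inductive vtype : Type := Gamma | Delta.

Section Weights.

Variable F : fieldType.
Implicit Types q z zi zj : F.

Definition primed q z : F := q + 1 - 1 / z.

(* Spins in the order left, top, right, bottom. *)
Definition gamma_weight q z (l t r b : spin) : F :=
  match l, t, r, b with
  | ⊕, ⊕, ⊕, ⊕ => 1
  | ⊖, ⊖, ⊖, ⊖ => 1
  | ⊕, ⊖, ⊕, ⊖ => z
  | ⊖, ⊕, ⊖, ⊕ => q * z
  | ⊖, ⊕, ⊕, ⊖ => 1 - q * z
  | ⊕, ⊖, ⊖, ⊕ => 1 - z
  | _, _, _, _ => 0
  end%spin.

Definition delta_weight q z (l t r b : spin) : F :=
  let z' := primed q z in
  match l, t, r, b with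
  | ⊕, ⊕, ⊕, ⊕ => 1
  | ⊖, ⊖, ⊖, ⊖ => 1
  | ⊕, ⊖, ⊕, ⊖ => z'
  | ⊖, ⊕, ⊖, ⊕ => 1 / q * z'
  | ⊖, ⊖, ⊕, ⊕ => 1 - z'
  | ⊕, ⊕, ⊖, ⊖ => 1 - 1 / q * z'
  | _, _, _, _ => 0
  end%spin.

Definition vertex_weight (X : vtype) q z : spin -> spin -> spin -> spin -> F :=
  match X with
  | Gamma => gamma_weight q z
  | Delta => delta_weight q z
  end.

(* Denominator of the R-weights, up to the factors of q, zi, zj whose
   nonvanishing is covered by vertex_defined below. *)
Definition R_denom (X Y : vtype) q zi zj : F :=
  let zi' := primed q zi in
  let zj' := primed q zj in
  match X, Y with
  | Gamma, Gamma => 1 - (q + 1) * zj + q * zi * zj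
  | Delta, Gamma => 1 - zi' * zj
  | Delta, Delta => q - (q + 1) * zi' + zi' * zj'
  | Gamma, Delta => zi * zj' - 1
  end.

(* Spins in the order bottom-left, top-left, top-right, bottom-right. *)
Definition R_gamma_gamma q zi zj (bl tl tr br : spin) : F :=
  let P := R_denom Gamma Gamma q zi zj in
  match bl, tl, tr, br with
  | ⊕, ⊕, ⊕, ⊕ => 1
  | ⊖, ⊖, ⊖, ⊖ => 1
  | ⊕, ⊖, ⊕, ⊖ => (zi - zj) / P
  | ⊖, ⊕, ⊖, ⊕ => q * (zi - zj) / P
  | ⊖, ⊕, ⊕, ⊖ => (1 - q * zi) * (1 - zj) / P
  | ⊕, ⊖, ⊖, ⊕ => (1 - zi) * (1 - q * zj) / P
  | _, _, _, _ => 0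
  end%spin.

Definition R_delta_gamma q zi zj (bl tl tr br : spin) : F :=
  let zi' := primed q zi in
  let D := R_denom Delta Gamma q zi zj in
  match bl, tl, tr, br with
  | ⊕, ⊕, ⊕, ⊕ => 1
  | ⊖, ⊖, ⊖, ⊖ => 1
  | ⊕, ⊖, ⊕, ⊖ => (zi' + q * zj - (q + 1) * zi' * zj) / D
  | ⊖, ⊕, ⊖, ⊕ => (q^-1 * zi' + zj - (1 + q^-1) * zi' * zj) / D
  | ⊖, ⊖, ⊕, ⊕ => (1 - zi') * (1 - q * zj) / D
  | ⊕, ⊕, ⊖, ⊖ => (1 - q^-1 * zi') * (1 - zj) / D
  | _, _, _, _ => 0
  end%spin.

Definition R_delta_delta q zi zj (bl tl tr br : spin) : F :=
  let zi' := primed q zi in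
  let zj' := primed q zj in
  let Q := R_denom Delta Delta q zi zj in
  match bl, tl, tr, br with
  | ⊕, ⊕, ⊕, ⊕ => 1
  | ⊖, ⊖, ⊖, ⊖ => 1
  | ⊕, ⊖, ⊕, ⊖ => (zj' - zi') / Q
  | ⊖, ⊕, ⊖, ⊕ => q * (zj' - zi') / Q
  | ⊖, ⊕, ⊕, ⊖ => (1 - zi') * (q - zj') / Q
  | ⊕, ⊖, ⊖, ⊕ => (1 - zj') * (q - zi') / Q
  | _, _, _, _ => 0
  end%spin.

Definition R_gamma_delta q zi zj (bl tl tr br : spin) : F :=
  let zj' := primed q zj in
  let D := R_denom Gamma Delta q zi zj in
  match bl, tl, tr, br with
  | ⊕, ⊕, ⊕, ⊕ => 1
  | ⊖, ⊖, ⊖, ⊖ => 1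
  | ⊕, ⊖, ⊕, ⊖ => (q * zi + zj' - (1 + q)) / D
  | ⊖, ⊕, ⊖, ⊕ => (q * zi + zj' - (1 + q)) / (q * D)
  | ⊖, ⊖, ⊕, ⊕ => (1 - q * zi) * (1 - zj') / D
  | ⊕, ⊕, ⊖, ⊖ => (1 - zi) * (q - zj') / (q * D)
  | _, _, _, _ => 0
  end%spin.

Definition R_weight (X Y : vtype) q zi zj : spin -> spin -> spin -> spin -> F :=
  match X, Y with
  | Gamma, Gamma => R_gamma_gamma q zi zj
  | Delta, Gamma => R_delta_gamma q zi zj
  | Delta, Delta => R_delta_delta q zi zj
  | Gamma, Delta => R_gamma_delta q zi zj
  end.

(* Nonvanishing of the denominators in the weights of an X vertex with
   parameter z; Gamma weights are polynomial, Delta weights involve 1/q, 1/z. *)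
Definition vertex_defined (X : vtype) q z : bool :=
  match X with
  | Gamma => true
  | Delta => (q != 0) && (z != 0)
  end.

End Weights.

(* Main.v *)
Require Import Defs.
From mathcomp Require Import all_boot all_algebra.
From mathcomp Require Import ring.
Import GRing.Theory.
Local Open Scope ring_scope.

(** A finite check: for each of the four type pairs and 64 boundary spin choices, expanding the sums
    leaves one identity of rational functions, settled by clearing denominators. *)

Lemma sum_spin (V : nmodType) (w : spin -> V) :
  \sum_(s : spin) w s = w Plus + w Minus.
Proof.
rewrite (bigD1 Plus) //= (bigD1 Minus) //= big_pred0 ?addr0 //.
by case.
Qed.

Theorem theorem2p1 (F : fieldType) (q zi zj : F) (X Y : vtype)
    (hX : vertex_defined X q zi) (hY : vertex_defined Y q zj)
    (hR : R_denom X Y q zi zj != 0)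
    (a b c d e f : spin) :
  let S := vertex_weight X q zi in
  let T := vertex_weight Y q zj in
  let R := R_weight X Y q zi zj in
  \sum_(g : spin) \sum_(h : spin) \sum_(k : spin)
      R a b g k * S g c d h * T k h e f
  = \sum_(j : spin) \sum_(m : spin) \sum_(l : spin)
      T b c j m * S a m l f * R l j d e.
Proof.
move=> S T R; rewrite !sum_spin /S /T /R {S T R}.
(* Any Delta vertex brings in [q^-1]; only Gamma-Gamma allows [q = 0]. *)
have hq : (if (X, Y) is (Gamma, Gamma) then true else q != 0).
  by case: X Y hX hY {hR} => [] [] //= hX hY; case/andP: hX || case/andP: hY.
(* The weights involve a Delta parameter z only through z' = q + 1 - 1/z, and
   the rational identities hold with z' an independent variable. *)
case: X Y hR hq {hX hY} => [] [] hR /= hq;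
  case: a; case: b; case: c; case: d; case: e; case: f;
  rewrite /= /R_denom in hR *;
  try move: (primed q zi) hR => zi' hR; try move: (primed q zj) hR => zj' hR;
  (* The denominators to clear are [q] and that of the R-vertex. *)
  by field; rewrite ?hR ?hq.
Qed.
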